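(* Let $\mathcal{C}$ be a pruned interpolant of an implication $A\to B$. Then there is an $\mathbf{LK}^-$ proof $\pi$ of the split sequent $A;\Rightarrow;B$ such that $\mathcal{C}$ subsumes $\mathrm{CNF}(\mathcal{M}(\pi))$.
   Context: Propositional formulas are built from atoms and $\bot$ using $\wedge,\vee,\neg$; $A\to B$ abbreviates $\neg A\vee B$; $\top$ abbreviates $\neg\bot\vee\bot$. $V(A)$ is the set of atoms of $A$. A literal is an atom (counting $\bot$ as an atom), a negated atom, or $\top$. A clause is a finite set of literals (read as disjunction), a clause set a set of clauses (read as conjunction). A clause set is pruned if no atom $p$ occurs in it both as $p$ and as $\neg p$ and it does not contain the literal $\top$. An interpolant of a valid $A\to B$ is a formula or clause set $C$ with $V(C)\subseteq V(A)\cap V(B)$ such that $A\to C$ and $C\to B$ are valid. A pruned interpolant of $A\to B$ is a pruned clause set $\mathcal{C}$ that is an interpolant of $A\to B$ such that there are no clauses $C'\subsetneq C\in\mathcal{C}$ with $A\models C'$. A clause set $\mathcal{A}$ subsumes $\mathcal{B}$ if for every $B\in\mathcal{B}$ there is $A\in\mathcal{A}$ with $A\subseteq B$. $\mathcal{C}\times\mathcal{D}=\{C\cup D\mid C\in\mathcal{C},D\in\mathcal{D}\}$; $\mathrm{CNF}$ is defined on formulas built from literals by $\wedge,\vee$: $\mathrm{CNF}(\top)=\emptyset$, $\mathrm{CNF}(\bot)=\{\emptyset\}$, $\mathrm{CNF}(\ell)=\{\{\ell\}\}$ for other literals, $\mathrm{CNF}(A\wedge B)=\mathrm{CNF}(A)\cup\mathrm{CNF}(B)$,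 $\mathrm{CNF}(A\vee B)=\mathrm{CNF}(A)\times\mathrm{CNF}(B)$. $\mathbf{LK}^-$ is the cut-free sequent calculus with axioms $p\Rightarrow p$ ($p$ an atom) and $\bot\Rightarrow$, and rules weakening, contraction, $(L\wedge_1),(L\wedge_2),(R\wedge),(R\vee_1),(R\vee_2),(L\vee),(L\neg),(R\neg)$ in standard Gentzen G1 form. A split sequent $\Gamma_1;\Gamma_2\Rightarrow\Delta_1;\Delta_2$ is the sequent $\Gamma_1,\Gamma_2\Rightarrow\Delta_1,\Delta_2$ with formulas divided into a left side ($\Gamma_1,\Delta_1$) and a right side ($\Gamma_2,\Delta_2$); in a proof of a split sequent every sequent is split, context formulas keep their side and auxiliary formulas lie on the side of the main formula. The Maehara interpolant $\mathcal{M}(\pi)$: axioms $p;\Rightarrow p;$ give $\bot$, $;p\Rightarrow;p$ give $\top$, $p;\Rightarrow;p$ give $p$, $;p\Rightarrow p;$ give $\neg p$, $\bot;\Rightarrow;$ gives $\bot$, $;\bot\Rightarrow;$ gives $\top$; unary rules keep the premise's interpolant; a binary rule ($(R\wedge)$ or $(L\vee)$) with premise proofs $\pi_1,\pi_2$ gives $\mathcal{M}(\pi_1)\vee\mathcal{M}(\pi_2)$ if its main formula is on the left side and $\mathcal{M}(\pi_1)\wedge\mathcal{M}(\pi_2)$ if on the right side. *)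

(* Defs.v *)
From HB Require Import structures.
From mathcomp Require Import all_boot.
From mathcomp Require Import finmap multiset.
From mathcomp Require Import boolp classical_sets.

Set Implicit Arguments.
Unset Strict Implicit.
Unset Printing Implicit Defensive.

(* The type T of atoms is arbitrary; [Bot] is not one of the atoms in T. *)
Inductive form (T : Type) : Type :=
| Atom of T
| Bot
| Neg of form T
| And of form T & form T
| Or of form T & form T.
Arguments Bot {T}.

Definition Imp (T : Type) (A B : form T) : form T := Or (Neg A) B.
Definition Top {T : Type} : form T := Or (Neg Bot) Bot.

Fixpoint form_tree (T : Type) (A : form T) : GenTree.tree T :=
  match A with
  | Atom p => GenTree.Leaf p
  | Bot => GenTree.Node 0 [::]
  | Neg B => GenTree.Node 1 [:: form_tree B]
  | And B C => GenTree.Node 2 [:: form_tree B; form_tree C]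
  | Or B C => GenTree.Node 3 [:: form_tree B; form_tree C]
  end.

Fixpoint tree_form (T : Type) (t : GenTree.tree T) : form T :=
  match t with
  | GenTree.Leaf p => Atom p
  | GenTree.Node 1 [:: u] => Neg (tree_form u)
  | GenTree.Node 2 [:: u; w] => And (tree_form u) (tree_form w)
  | GenTree.Node 3 [:: u; w] => Or (tree_form u) (tree_form w)
  | _ => Bot
  end.

Lemma form_treeK (T : Type) : cancel (@form_tree T) (@tree_form T).
Proof. by elim=> //= [A -> | A -> B -> | A -> B ->]. Qed.

HB.instance Definition _ (T : choiceType) :=
  Choice.copy (form T) (can_type (@form_treeK T)).

(* [LBot] and [LNegBot] are there because bottom counts as an atom when
   literals are formed. *)
Inductive literal (T : Type) : Type :=
| LAtom of T
| LNegAtom of T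
| LBot
| LNegBot
| LTop.
Arguments LBot {T}.
Arguments LNegBot {T}.
Arguments LTop {T}.

Definition lit_form (T : Type) (l : literal T) : form T :=
  match l with
  | LAtom p => Atom p
  | LNegAtom p => Neg (Atom p)
  | LBot => Bot
  | LNegBot => Neg Bot
  | LTop => Top
  end.

Definition lit_code (T : Type) (l : literal T) : option (bool * option T) :=
  match l with
  | LAtom p => Some (true, Some p)
  | LNegAtom p => Some (false, Some p)
  | LBot => Some (true, None)
  | LNegBot => Some (false, None)
  | LTop => None
  end.

Definition code_lit (T : Type) (x : option (bool * option T)) : literal T :=
  match x with
  | Some (true, Some p) => LAtom p
  | Some (false, Some p) => LNegAtom p
  | Some (true, None) => LBot
  | Some (false, None) => LNegBot
  | None => LTop
  end.

Lemma lit_codeK (T : Type) : cancel (@lit_code T) (@code_lit T).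
Proof. by case. Qed.

HB.instance Definition _ (T : choiceType) :=
  Choice.copy (literal T) (can_type (@lit_codeK T)).

Local Open Scope classical_set_scope.

Notation clause T := {fset literal T}.
Notation clause_set T := (set (clause T)).

Fixpoint eval (T : Type) (v : T -> bool) (A : form T) : bool :=
  match A with
  | Atom p => v p
  | Bot => false
  | Neg B => ~~ eval v B
  | And B C => eval v B && eval v C
  | Or B C => eval v B || eval v C
  end.

Definition valid (T : Type) (A : form T) : Prop := forall v, eval v A.

Section Semantics.
Variable T : choiceType.
Implicit Types (A B : form T) (c d : clause T) (C D : clause_set T).

Definition clause_true (v : T -> bool) c : Prop :=
  exists2 l, l \in c & eval v (lit_form l).

Definition clause_set_true (v : T -> bool) C : Prop :=
  forall c, C c -> clause_true v c.

Definition entails_clause A c : Prop :=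
  forall v, eval v A -> clause_true v c.

Fixpoint atoms A : set T :=
  match A with
  | Atom p => [set p]
  | Bot => set0
  | Neg B => atoms B
  | And B C => atoms B `|` atoms C
  | Or B C => atoms B `|` atoms C
  end.

Definition clause_set_atoms C : set T :=
  [set p | exists2 c, C c & exists2 l, l \in c & atoms (lit_form l) p].

Definition pruned C : Prop :=
  (forall p, ~ ((exists2 c, C c & LAtom p \in c) /\
                (exists2 c, C c & LNegAtom p \in c))) /\
  (forall c, C c -> LTop \notin c).

Definition interpolant A B C : Prop :=
  [/\ valid (Imp A B),
      clause_set_atoms C `<=` atoms A `&` atoms B,
      forall v, eval v A -> clause_set_true v C
    & forall v, clause_set_true v C -> eval v B].

Definition pruned_interpolant A B C : Prop :=
  [/\ pruned C, interpolant A B C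
    & forall c c', C c -> (c' `<` c)%fset -> ~ entails_clause A c'].

Definition subsumes C D : Prop :=
  forall d, D d -> exists2 c, C c & (c `<=` d)%fset.

Definition clause_set_times C D : clause_set T :=
  [set e | exists2 c, C c & exists2 d, D d & e = (c `|` d)%fset].

End Semantics.

(* Formulas built from literals by conjunction and disjunction. The literal
   top is a leaf, so that it is not confused with the disjunction of the
   literals "not bottom" and bottom that it abbreviates. *)
Inductive nnf (T : Type) : Type :=
| NLit of literal T
| NAnd of nnf T & nnf T
| NOr of nnf T & nnf T.

Fixpoint nnf_form (T : Type) (M : nnf T) : form T :=
  match M with
  | NLit l => lit_form l
  | NAnd M1 M2 => And (nnf_form M1) (nnf_form M2)
  | NOr M1 M2 => Or (nnf_form M1) (nnf_form M2)
  end.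

Fixpoint CNF (T : choiceType) (M : nnf T) : clause_set T :=
  match M with
  | NLit LTop => set0
  | NLit LBot => [set fset0]
  | NLit l => [set [fset l]%fset]
  | NAnd M1 M2 => CNF M1 `|` CNF M2
  | NOr M1 M2 => clause_set_times (CNF M1) (CNF M2)
  end.

Local Open Scope mset_scope.

(* A split sequent is a pair of multisets of formulas tagged with their side:
   G1; G2 => D1; D2 has antecedent lft G1, rgt G2 and succedent lft D1, rgt D2. *)
Notation side := bool (only parsing).
Notation lft := true (only parsing).
Notation rgt := false (only parsing).
Notation split_cedent T := {mset (side * form T)%type}%mset.

(* Cedents being multisets, no exchange rule is needed. The two-premise rules
   share their context, as in G1. *)
Inductive LK (T : choiceType) : split_cedent T -> split_cedent T -> Type :=
| AxAtom (s t : side) (p : T) : LK [mset (s, Atom p)] [mset (t, Atom p)]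
| AxBot (s : side) : LK [mset (s, Bot)] mset0
| LWeak (s : side) (A : form T) G D : LK G D -> LK ((s, A) +` G) D
| RWeak (s : side) (A : form T) G D : LK G D -> LK G ((s, A) +` D)
| LContr (s : side) (A : form T) G D :
    LK ((s, A) +` ((s, A) +` G)) D -> LK ((s, A) +` G) D
| RContr (s : side) (A : form T) G D :
    LK G ((s, A) +` ((s, A) +` D)) -> LK G ((s, A) +` D)
| LAnd1 (s : side) (A B : form T) G D :
    LK ((s, A) +` G) D -> LK ((s, And A B) +` G) D
| LAnd2 (s : side) (A B : form T) G D :
    LK ((s, B) +` G) D -> LK ((s, And A B) +` G) D
| RAnd (s : side) (A B : form T) G D :
    LK G ((s, A) +` D) -> LK G ((s, B) +` D) -> LK G ((s, And A B) +` D)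
| ROr1 (s : side) (A B : form T) G D :
    LK G ((s, A) +` D) -> LK G ((s, Or A B) +` D)
| ROr2 (s : side) (A B : form T) G D :
    LK G ((s, B) +` D) -> LK G ((s, Or A B) +` D)
| LOr (s : side) (A B : form T) G D :
    LK ((s, A) +` G) D -> LK ((s, B) +` G) D -> LK ((s, Or A B) +` G) D
| LNeg (s : side) (A : form T) G D :
    LK G ((s, A) +` D) -> LK ((s, Neg A) +` G) D
| RNeg (s : side) (A : form T) G D :
    LK ((s, A) +` G) D -> LK G ((s, Neg A) +` D).

Fixpoint maehara (T : choiceType) (G D : split_cedent T) (pi : LK G D) :
    nnf T :=
  match pi with
  | AxAtom s t p =>
      match s, t with
      | lft, lft => NLit LBot
      | rgt, rgt => NLit LTop
      | lft, rgt => NLit (LAtom p)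
      | rgt, lft => NLit (LNegAtom p)
      end
  | AxBot s => if s is lft then NLit LBot else NLit LTop
  | LWeak _ _ _ _ pi1 => maehara pi1
  | RWeak _ _ _ _ pi1 => maehara pi1
  | LContr _ _ _ _ pi1 => maehara pi1
  | RContr _ _ _ _ pi1 => maehara pi1
  | LAnd1 _ _ _ _ _ pi1 => maehara pi1
  | LAnd2 _ _ _ _ _ pi1 => maehara pi1
  | RAnd s _ _ _ _ pi1 pi2 =>
      if s is lft then NOr (maehara pi1) (maehara pi2)
      else NAnd (maehara pi1) (maehara pi2)
  | ROr1 _ _ _ _ _ pi1 => maehara pi1
  | ROr2 _ _ _ _ _ pi1 => maehara pi1
  | LOr s _ _ _ _ pi1 pi2 =>
      if s is lft then NOr (maehara pi1) (maehara pi2)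
      else NAnd (maehara pi1) (maehara pi2)
  | LNeg _ _ _ _ pi1 => maehara pi1
  | RNeg _ _ _ _ pi1 => maehara pi1
  end.

(* Main.v *)
(** A sequent is read as a list of signed formulas, so that its logical rules
    reduce to one negation rule, one rule with a single premise and one with
    two, all of them invertible. Decompose [B] first. In a leaf that is not an
    axiom, all literals of some clause [c] of [C] occur: otherwise, as each atom
    has only one polarity in [C], the atoms outside the leaf could be chosen so
    that [C] is true while the leaf, hence [B], is false. Over such a leaf
    decompose [A]: now every leaf is an axiom contributing either bottom or a
    literal of [c], and left rules take disjunctions, so the interpolant of that
    subproof is a single clause contained in [c] and entailed by [A]; minimality
    makes it equal to [c]. Right rules take conjunctions, so only clauses of [C]
    are collected. *)
Require Import Defs.
From mathcomp Require Import all_boot finmap multiset boolp classical_sets.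

Set Implicit Arguments.
Unset Strict Implicit.
Unset Printing Implicit Defensive.

Local Open Scope classical_set_scope.

(* The sign is [true] in the antecedent and [false] in the succedent. *)
Notation sequent T := (seq (bool * form T)).
Notation split_sequent T := (seq (side * (bool * form T))).

Section SignedFormulas.
Variable T : choiceType.
Implicit Types (A B : form T) (X Y : sequent T) (v : T -> bool).

(* Smullyan's uniform notation: with sign [b], [junction b] decomposes without
   branching and [junction (~~ b)] branches. *)
Definition junction (b : bool) A B : form T := if b then And A B else Or A B.

Definition atomic (x : bool * form T) : bool :=
  match x.2 with Atom _ | Bot => true | _ => false end.

Lemma sequent_ind (Q : sequent T -> Prop) :
  (forall X Y, perm_eq X Y -> Q X -> Q Y) ->
  (forall b A X, Q ((~~ b, A) :: X) -> Q ((b, Neg A) :: X)) ->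
  (forall b A B X,
     Q [:: (b, A), (b, B) & X] -> Q ((b, junction b A B) :: X)) ->
  (forall b A B X, Q ((b, A) :: X) -> Q ((b, B) :: X) ->
     Q ((b, junction (~~ b) A B) :: X)) ->
  (forall X, all atomic X -> Q X) ->
  forall X, Q X.
Proof.
move=> Qperm Qneg Qunary Qbinary Qatomic X.
suff: forall Y, all atomic Y -> Q (X ++ Y).
  by move=> /(_ [::] isT); rewrite cats0.
elim: X => // -[b A].
elim: A b => [p||A IHA|A IHA B IHB|A IHA B IHB] b X QX Y aY.
- apply: Qperm (QX ((b, Atom p) :: Y) aY).
  by rewrite -cat1s perm_catCA.
- apply: Qperm (QX ((b, Bot) :: Y) aY).
  by rewrite -cat1s perm_catCA.
- by apply: Qneg; apply: IHA.
- case: b; last by apply: (Qbinary false); [apply: IHA | apply: IHB].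
  by apply: (Qunary true); apply: (IHA _ (_ :: _)) => //; apply: IHB.
- case: b; first by apply: (Qbinary true); [apply: IHA | apply: IHB].
  by apply: (Qunary false); apply: (IHA _ (_ :: _)) => //; apply: IHB.
Qed.

Definition sequent_true v X : bool := has (fun x => eval v x.2 != x.1) X.

Definition valid_sequent X : Prop := forall v, sequent_true v X.

Lemma valid_sequent_subset X Y :
  {subset X <= Y} -> valid_sequent X -> valid_sequent Y.
Proof.
move=> XY validX v; have /hasP[x xX vx] := validX v.
by apply/hasP; exists x; first exact: XY.
Qed.

Lemma sequent_true_Neg v b A X :
  sequent_true v ((b, Neg A) :: X) = sequent_true v ((~~ b, A) :: X).
Proof. by rewrite /sequent_true /=; case: b; case: eval. Qed.

Lemma sequent_true_junction v b A B X :
  sequent_true v ((b, junction b A B) :: X) =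
  sequent_true v [:: (b, A), (b, B) & X].
Proof. by rewrite /sequent_true; case: b => /=; do 2 case: eval. Qed.

Lemma sequent_true_junctionN v b A B X :
  sequent_true v ((b, junction (~~ b) A B) :: X) =
  sequent_true v ((b, A) :: X) && sequent_true v ((b, B) :: X).
Proof.
rewrite /sequent_true.
by case: b => /=; do 2 case: eval => //=; case: (has _ X).
Qed.

Variant closed X : Prop :=
| closed_Bot of (true, Bot) \in X
| closed_Atom b p of (b, Atom p) \in X & (~~ b, Atom p) \in X.

Lemma closed_valid X : closed X -> valid_sequent X.
Proof.
case=> [botX | b p pX npX] v; apply/hasP; first by exists (true, Bot).
have [vb|vNb] := eqVneq (v p) b; last by exists (b, Atom p).
by exists (~~ b, Atom p) => //=; rewrite vb; case: (b).
Qed.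

Lemma atomic_sequent_false v X :
  all atomic X -> (true, Bot) \notin X ->
  (forall b p, (b, Atom p) \in X -> v p = b) -> ~~ sequent_true v X.
Proof.
move=> /allP aX botX vX; apply/hasPn => -[b A] bAX; have := aX _ bAX.
case: A bAX => // [p|] bAX _; first by rewrite /= (vX _ _ bAX) eqxx.
by case: b bAX => //; rewrite (negPf botX).
Qed.

Lemma atomic_valid_closed X : all atomic X -> valid_sequent X -> closed X.
Proof.
move=> aX validX; apply: contrapT => openX.
pose v p := (true, Atom p) \in X.
have /negP[] : ~~ sequent_true v X; last exact: validX.
apply: atomic_sequent_false => // [|[] p pX]; first 2 last.
- by apply/negP => npX; apply: openX; apply: closed_Atom pX npX.
- by apply/negP => botX; apply: openX; apply: closed_Bot.
- exact: pX.
Qed.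

End SignedFormulas.

Arguments atomic {T}.

Section Clauses.
Variable T : choiceType.
Implicit Types (c d : clause T) (C : clause_set T) (l : literal T).
Implicit Types (A : form T) (X Y : sequent T) (v : T -> bool).

Definition signed_literal l : bool * form T :=
  match l with
  | LAtom p => (false, Atom p)
  | LNegAtom p => (true, Atom p)
  | LBot => (false, Bot)
  | LNegBot => (true, Bot)
  | LTop => (false, Top)
  end.

Lemma eval_signed_literal v l :
  (eval v (signed_literal l).2 != (signed_literal l).1) = eval v (lit_form l).
Proof. by case: l => //= p; case: (v p). Qed.

Definition clause_sequent c : sequent T := [seq signed_literal l | l <- c].

Lemma clause_trueP v c :
  reflect (clause_true v c) (sequent_true v (clause_sequent c)).
Proof.
rewrite /sequent_true has_map; under eq_has do rewrite /= eval_signed_literal.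
exact: hasP.
Qed.

Lemma valid_clause_fsubset X c d :
  (c `<=` d)%fset ->
  valid_sequent (X ++ clause_sequent c) ->
  valid_sequent (X ++ clause_sequent d).
Proof.
move=> /fsubsetP cd; apply: valid_sequent_subset => x; rewrite !mem_cat.
by case/orP=> [->//|/mapP[l /cd ld ->]]; rewrite [X in _ || X]map_f ?orbT.
Qed.

Lemma clause_set_times11 c d :
  clause_set_times [set c] [set d] = [set (c `|` d)%fset].
Proof.
apply/seteqP; split=> e /=; first by case=> _ -> [_ ->].
by move=> ->; exists c => //; exists d.
Qed.

Lemma entails_clauseE A c :
  entails_clause A c <-> valid_sequent ((true, A) :: clause_sequent c).
Proof.
split=> Ac v; first last.
  by move=> Av; apply/clause_trueP; have := Ac v; rewrite /sequent_true /= Av.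
rewrite /sequent_true /=; case Av: (eval v A) => //=.
exact/clause_trueP/Ac.
Qed.

Definition entails_sequent C X : Prop :=
  forall v, clause_set_true v C -> sequent_true v X.

(* [(false, Bot)] is added because a clause may contain the literal bottom. *)
Lemma pruned_clause_within_sequent C Y :
  pruned C -> all atomic Y -> ~ closed Y -> entails_sequent C Y ->
  exists2 c, C c & {subset clause_sequent c <= (false, Bot) :: Y}.
Proof.
move=> [polarity _] aY openY CY.
pose positive p := `[< exists2 c, C c & LAtom p \in c >].
pose v p := ((true, Atom p) \in Y) || ((false, Atom p) \notin Y) && positive p.
have vY b p : (b, Atom p) \in Y -> v p = b.
  rewrite /v; case: b => [->//|npY]; rewrite npY orbF; apply/negP => pY.
  by apply: openY; apply: closed_Atom pY npY.
have falseY : ~~ sequent_true v Y.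
  apply: atomic_sequent_false => //; apply/negP => botY.
  by apply: openY; apply: closed_Bot.
have [c Cc falsec] : exists2 c, C c & ~ clause_true v c.
  apply: contrapT => trueC; case/negP: falseY; apply: CY => c Cc.
  by apply: contrapT => falsec; apply: trueC; exists c.
exists c => // _ /mapP[l lc ->].
have {falsec} : ~~ eval v (lit_form l).
  by apply/negP => vl; apply: falsec; exists l.
rewrite inE; case: l lc => [p|p|||] lc //=.
- rewrite /v negb_or => /andP[_]; apply: contraNT => ->.
  by apply/asboolP; exists c.
- rewrite negbK => /orP[//|/andP[_ /asboolP pos]].
  by case: (polarity p); split=> //; exists c.
Qed.

End Clauses.

Section Provability.
Variable T : choiceType.
Implicit Types (A B : form T) (X : sequent T) (Z : split_sequent T).
Implicit Types (S : clause_set T).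

Definition cedent (b : bool) Z : {mset (side * form T)%type}%mset :=
  seq_mset [seq (z.1, z.2.2) | z <- Z & z.2.1 == b].

Definition cnf_provable Z S : Prop :=
  exists pi : LK (cedent true Z) (cedent false Z), CNF (maehara pi) = S.

Lemma cnf_provable_perm Z Z' S :
  perm_eq Z Z' -> cnf_provable Z S -> cnf_provable Z' S.
Proof.
move=> eqZ; rewrite /cnf_provable.
suff eq_cedent b : cedent b Z = cedent b Z' by rewrite !eq_cedent.
by apply/eq_seq_msetP; apply/perm_map/perm_filter.
Qed.

Lemma cnf_provable_weakening z Z S :
  cnf_provable Z S -> cnf_provable (z :: Z) S.
Proof.
case: z => s [[] A] [pi <-]; rewrite /cnf_provable /cedent /= mset_cons.
  by exists (LWeak s A pi).
by exists (RWeak s A pi).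
Qed.

Lemma cnf_provable_contraction z Z S :
  cnf_provable [:: z, z & Z] S -> cnf_provable (z :: Z) S.
Proof.
case: z => s [[] A]; rewrite /cnf_provable /cedent /= !mset_cons => -[pi <-].
  by exists (LContr pi).
by exists (RContr pi).
Qed.

Lemma cnf_provable_subset Z Z' S :
  {subset Z <= Z'} -> cnf_provable Z S -> cnf_provable Z' S.
Proof.
move=> + pZ; have {pZ} : cnf_provable (Z ++ Z') S.
  apply: (@cnf_provable_perm (Z' ++ Z)); first by rewrite perm_catC.
  by elim: Z' => //= z Z' IHZ'; apply: cnf_provable_weakening.
elim: Z => //= z Z IHZ pzZ sub; apply: IHZ => [|y yZ]; last first.
  by apply: sub; rewrite inE yZ orbT.
have zZ' : z \in Z ++ Z' by rewrite mem_cat sub ?inE ?eqxx ?orbT.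
have eqZ := perm_to_rem zZ'.
apply: cnf_provable_perm (_ : cnf_provable (z :: rem z (Z ++ Z')) S).
  by rewrite perm_sym.
apply: cnf_provable_contraction; apply: cnf_provable_perm pzZ.
by rewrite perm_cons.
Qed.

Lemma cnf_provable_Neg s b A Z S :
  cnf_provable ((s, (~~ b, A)) :: Z) S -> cnf_provable ((s, (b, Neg A)) :: Z) S.
Proof.
case: b; rewrite /cnf_provable /cedent /= !mset_cons => -[pi <-].
  by exists (LNeg pi).
by exists (RNeg pi).
Qed.

Lemma cnf_provable_junctionl s b A B Z S :
  cnf_provable ((s, (b, A)) :: Z) S ->
  cnf_provable ((s, (b, junction b A B)) :: Z) S.
Proof.
case: b; rewrite /cnf_provable /cedent /= !mset_cons => -[pi <-].
  by exists (LAnd1 B pi).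
by exists (ROr1 B pi).
Qed.

Lemma cnf_provable_junctionr s b A B Z S :
  cnf_provable ((s, (b, B)) :: Z) S ->
  cnf_provable ((s, (b, junction b A B)) :: Z) S.
Proof.
case: b; rewrite /cnf_provable /cedent /= !mset_cons => -[pi <-].
  by exists (LAnd2 A pi).
by exists (ROr2 A pi).
Qed.

Lemma cnf_provable_junction s b A B Z S :
  cnf_provable [:: (s, (b, A)), (s, (b, B)) & Z] S ->
  cnf_provable ((s, (b, junction b A B)) :: Z) S.
Proof.
move=> /(cnf_provable_junctionl B) pZ.
apply/cnf_provable_contraction/cnf_provable_junctionr.
by apply: cnf_provable_perm pZ; rewrite (perm_catCA [:: _] [:: _]).
Qed.

Definition maehara_join (s : side) S1 S2 : clause_set T :=
  if s is lft then clause_set_times S1 S2 else S1 `|` S2.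

Lemma cnf_provable_junctionN s b A B Z S1 S2 :
  cnf_provable ((s, (b, A)) :: Z) S1 -> cnf_provable ((s, (b, B)) :: Z) S2 ->
  cnf_provable ((s, (b, junction (~~ b) A B)) :: Z) (maehara_join s S1 S2).
Proof.
case: b; rewrite /cnf_provable /cedent /= !mset_cons => -[pi1 <-] [pi2 <-].
  by exists (LOr pi1 pi2); case: s pi1 pi2.
by exists (RAnd pi1 pi2); case: s pi1 pi2.
Qed.

Lemma seq_mset0 (K : choiceType) : seq_mset [::] = @mset0 K.
Proof. by apply/msetP => x; rewrite mset_seqE mset0E. Qed.

Lemma seq_mset1 (K : choiceType) (x : K) : seq_mset [:: x] = [mset x]%mset.
Proof. by rewrite mset_cons seq_mset0 msetD0. Qed.

Lemma cnf_provable_AxBot s Z :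
  (s, (true, Bot)) \in Z -> cnf_provable Z (CNF (maehara (AxBot T s))).
Proof.
move=> botZ; apply: (@cnf_provable_subset [:: (s, (true, Bot))]).
  by move=> z; rewrite inE => /eqP ->.
by rewrite /cnf_provable /cedent /= seq_mset0 seq_mset1; exists (AxBot T s).
Qed.

Lemma cnf_provable_AxAtom s t p Z :
  (s, (true, Atom p)) \in Z -> (t, (false, Atom p)) \in Z ->
  cnf_provable Z (CNF (maehara (AxAtom s t p))).
Proof.
move=> sZ tZ.
apply: (@cnf_provable_subset [:: (s, (true, Atom p)); (t, (false, Atom p))]).
  by move=> z; rewrite !inE => /orP[] /eqP ->.
by rewrite /cnf_provable /cedent /= !seq_mset1; exists (AxAtom s t p).
Qed.

Definition on_side (s : side) X : split_sequent T := [seq (s, x) | x <- X].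

Lemma mem_on_side s x X : ((s, x) \in on_side s X) = (x \in X).
Proof. by rewrite mem_map // => y z []. Qed.

Lemma cnf_provable_closed s X Z :
  closed X -> cnf_provable (on_side s X ++ Z) (CNF (maehara (AxBot T s))).
Proof.
case=> [botX | b p pX npX].
  by apply: cnf_provable_AxBot; rewrite mem_cat mem_on_side botX.
have [pX' npX'] : (true, Atom p) \in X /\ (false, Atom p) \in X.
  by case: b pX npX.
have -> : maehara (AxBot T s) = maehara (AxAtom s s p) by case: s.
by apply: cnf_provable_AxAtom; rewrite mem_cat mem_on_side ?pX' ?npX'.
Qed.

Lemma cnf_provable_literal l b p Z :
  signed_literal l = (b, Atom p) ->
  (lft, (~~ b, Atom p)) \in Z -> (rgt, (b, Atom p)) \in Z ->
  cnf_provable Z [set [fset l]%fset].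
Proof.
case: l => // q [<- ->] lZ rZ.
  exact: (cnf_provable_AxAtom lZ rZ).
exact: (cnf_provable_AxAtom rZ lZ).
Qed.

End Provability.

Section InterpolantClauses.
Variable T : choiceType.
Implicit Types (A B : form T) (X Y : sequent T) (Z : split_sequent T).
Implicit Types (c d : clause T) (C S : clause_set T).

Definition interpolated_within c X Y : Prop :=
  exists d, [/\ (d `<=` c)%fset, valid_sequent (X ++ clause_sequent d)
    & cnf_provable (on_side lft X ++ on_side rgt Y) [set d]].

Lemma atomic_interpolated_within c X Y :
  all atomic X -> all atomic Y -> ~ closed Y ->
  {subset clause_sequent c <= (false, Bot) :: Y} ->
  valid_sequent (X ++ clause_sequent c) ->
  interpolated_within c X Y.
Proof.
move=> aX aY openY cY validXc.
have atom_cY b p : (b, Atom p) \in clause_sequent c -> (b, Atom p) \in Y.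
  by move=> /cY; rewrite inE => /orP[/eqP|].
have closedX : closed X -> interpolated_within c X Y.
  move=> closedX; exists fset0; split; first exact: fsub0set.
    by rewrite cats0; apply: closed_valid.
  exact: (@cnf_provable_closed _ lft).
have clash b p : (~~ b, Atom p) \in X -> (b, Atom p) \in clause_sequent c ->
    interpolated_within c X Y.
  move=> npX pc; have /mapP[l lc eql] := pc; exists [fset l]%fset; split.
  - by rewrite fsub1set.
  - apply: closed_valid; apply: (@closed_Atom _ _ b p); rewrite mem_cat ?npX //.
    by rewrite eql map_f ?orbT // inE.
  - apply: cnf_provable_literal (esym eql) _ _.
      by rewrite mem_cat mem_on_side npX.
    by rewrite mem_cat [X in _ || X]mem_on_side atom_cY ?orbT.
have : closed (X ++ clause_sequent c).
  apply: atomic_valid_closed => //; rewrite all_cat aX.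
  by apply/allP => x /cY; rewrite inE => /orP[/eqP-> | /(allP aY)].
case=> [|b p]; rewrite !mem_cat.
  case/orP=> [botX | /cY]; first exact/closedX/closed_Bot.
  by rewrite inE /= => botY; case: openY; apply: closed_Bot.
move=> /orP[pX | pc] /orP[npX | npc].
- exact/closedX/(closed_Atom pX npX).
- by apply: clash npc; rewrite negbK.
- exact: clash npX pc.
- by case: openY; apply: closed_Atom (atom_cY _ _ pc) (atom_cY _ _ npc).
Qed.

Lemma valid_interpolated_within c Y :
  all atomic Y -> ~ closed Y ->
  {subset clause_sequent c <= (false, Bot) :: Y} ->
  forall X, valid_sequent (X ++ clause_sequent c) ->
  interpolated_within c X Y.
Proof.
move=> aY openY cY.
apply: sequent_ind => [X1 X2 eqX|b A X|b A B X|b A B X|X aX].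
- move=> IH validX2.
  have [|d [dc validd pd]] := IH.
    apply: valid_sequent_subset validX2 => x.
    by rewrite !mem_cat (perm_mem eqX).
  exists d; split=> //.
    by apply: valid_sequent_subset validd => x; rewrite !mem_cat (perm_mem eqX).
  by apply: cnf_provable_perm pd; rewrite perm_cat2r perm_map.
- move=> IH validNeg; have [|d [dc validd pd]] := IH.
    by move=> v; have := validNeg v; rewrite sequent_true_Neg.
  exists d; split=> //; last exact: cnf_provable_Neg.
  by move=> v; rewrite cat_cons sequent_true_Neg.
- move=> IH validJ; have [|d [dc validd pd]] := IH.
    by move=> v; have := validJ v; rewrite sequent_true_junction.
  exists d; split=> //; last exact: cnf_provable_junction.
  by move=> v; rewrite cat_cons sequent_true_junction.
- move=> IHA IHB validJ.
  have [validA validB] :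
      valid_sequent ((b, A) :: X ++ clause_sequent c) /\
      valid_sequent ((b, B) :: X ++ clause_sequent c).
    split=> v; move: (validJ v);
      by rewrite cat_cons sequent_true_junctionN => /andP[].
  have [d1 [d1c valid1 p1]] := IHA validA.
  have [d2 [d2c valid2 p2]] := IHB validB.
  exists (d1 `|` d2)%fset; split; first by rewrite fsubUset d1c.
    move=> v; rewrite cat_cons sequent_true_junctionN.
    rewrite (valid_clause_fsubset _ valid1) ?fsubsetUl //.
    by rewrite (valid_clause_fsubset _ valid2) ?fsubsetUr.
  by rewrite -clause_set_times11; apply: (@cnf_provable_junctionN _ lft).
- exact: atomic_interpolated_within.
Qed.

Lemma cnf_provable_of_leaves Z C :
  (forall Y, all atomic Y -> ~ closed Y -> entails_sequent C Y ->
     exists2 c, C c & cnf_provable (on_side rgt Y ++ Z) [set c]) ->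
  forall Y, entails_sequent C Y ->
  exists2 S, S `<=` C & cnf_provable (on_side rgt Y ++ Z) S.
Proof.
move=> leaf; apply: sequent_ind => [Y1 Y2 eqY|b A Y|b A B Y|b A B Y|Y aY].
- move=> IH CY2; have [v /CY2|S SC pS] := IH.
    by rewrite /sequent_true (perm_has _ eqY).
  by exists S => //; apply: cnf_provable_perm pS; rewrite perm_cat2r perm_map.
- move=> IH CNeg; have [v /CNeg|S SC pS] := IH.
    by rewrite sequent_true_Neg.
  by exists S => //; apply: cnf_provable_Neg.
- move=> IH CJ; have [v /CJ|S SC pS] := IH.
    by rewrite sequent_true_junction.
  by exists S => //; apply: cnf_provable_junction.
- move=> IHA IHB CJ.
  have [v /CJ|S1 S1C p1] := IHA.
    by rewrite sequent_true_junctionN => /andP[].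
  have [v /CJ|S2 S2C p2] := IHB.
    by rewrite sequent_true_junctionN => /andP[].
  exists (S1 `|` S2); first by rewrite subUset.
  exact: (@cnf_provable_junctionN _ rgt).
- move=> CY; have [closedY | openY] := pselect (closed Y).
    by exists set0; [exact: sub0set | exact: (@cnf_provable_closed _ rgt)].
  by have [c Cc pc] := leaf Y aY openY CY; exists [set c] => // _ ->.
Qed.

Lemma pruned_interpolant_leaf_clause A B C Y :
  pruned_interpolant A B C ->
  all atomic Y -> ~ closed Y -> entails_sequent C Y ->
  exists2 c, C c &
    cnf_provable (on_side rgt Y ++ [:: (lft, (true, A))]) [set c].
Proof.
case=> prunedC [_ _ AC _] minC aY openY CY.
have [c Cc cY] := pruned_clause_within_sequent prunedC aY openY CY.
have validAc : valid_sequent ((true, A) :: clause_sequent c).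
  by apply/entails_clauseE => v Av; apply: AC.
have [d [dc /entails_clauseE Ad pd]] :=
  valid_interpolated_within aY openY cY (X := [:: (true, A)]) validAc.
exists c => //; have [<-|neqdc] := eqVneq d c.
  by apply: cnf_provable_perm pd; rewrite perm_catC.
by case: (minC c d Cc _ Ad); rewrite fproperEneq neqdc.
Qed.

End InterpolantClauses.

Theorem theorem5p10 (T : choiceType) (A B : form T) (C : clause_set T)
    (hC : pruned_interpolant A B C) :
  exists pi : LK [mset (lft, A)]%mset [mset (rgt, B)]%mset,
    subsumes C (CNF (maehara pi)).
Proof.
have [_ [_ _ _ CB] _] := hC.
have leaf Y := @pruned_interpolant_leaf_clause T A B C Y hC.
have [v /CB|S SC] := cnf_provable_of_leaves leaf (Y := [:: (false, B)]).
  by rewrite /sequent_true /= orbF eqbF_neg negbK.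
rewrite /cnf_provable /cedent /= !seq_mset1 => -[pi cnf_pi].
by exists pi => d; rewrite cnf_pi => /SC Cd; exists d.
Qed.
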